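(* Let $Q(x,y,z)$ be any positive definite ternary quadratic form with rational coefficients. Then there is an infinite arithmetic progression of positive integers none of whose members is represented by $Q$ over the rational numbers.
   Context: A number $N$ is represented by $Q$ over the rational numbers if there exist $x,y,z\in\mathbb{Q}$ with $Q(x,y,z)=N$. *)

(* Defs.v *)
From mathcomp Require Import all_boot all_order all_algebra.
From mathcomp Require Import mpoly.

Set Implicit Arguments.
Unset Strict Implicit.
Unset Printing Implicit Defensive.

Import GRing.Theory Num.Theory.
Local Open Scope ring_scope.

(* The zero polynomial is homogeneous of every degree, so the zero form counts
   as a quadratic form. *)
Definition is_ternary_qform (Q : {mpoly rat[3]}) : Prop := Q \is 2.-homog.

Definition qform_eval (Q : {mpoly rat[3]}) (x y z : rat) : rat :=
  Q.@[tnth [tuple x; y; z]].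

Definition posdef_qform (Q : {mpoly rat[3]}) : Prop :=
  forall x y z : rat, (x, y, z) <> (0, 0, 0) -> 0 < qform_eval Q x y z.

Definition represented_over_rat (Q : {mpoly rat[3]}) (N : rat) : Prop :=
  exists x y z : rat, qform_eval Q x y z = N.

(* Main.v *)
(** Up to a positive rational factor, a positive definite ternary form is
    rationally equivalent to [<A, B, A B>] with [A] and [B] positive integers;
    Legendre's descent is run on [A + B].  Square factors of [A] and [B] can be
    removed, so let [A <= B] with [B] squarefree.  If [- A] is not a square
    modulo some prime [p | B], the form is anisotropic over [Q_p] and misses
    every [N = -1 mod p].  Otherwise [t ^ 2 + A = B B'] with [t <= B / 2], and
    as [B B'] is a norm from [Q(sqrt (- A))] the form is equivalent to
    [<A, B', A B'>], where [B' < B] unless [B = 1].  The descent thus ends at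
    [x ^ 2 + y ^ 2 + z ^ 2], which misses every [N = 7 mod 8]. *)
Require Import Defs.
From mathcomp Require Import all_boot all_order all_algebra.
From mathcomp Require Import mpoly.
From mathcomp Require Import zify ring.
From Stdlib Require Import Classical.

Set Implicit Arguments.
Unset Strict Implicit.
Unset Printing Implicit Defensive.

Import Order.TTheory GRing.Theory Num.Theory.

Local Open Scope ring_scope.

(** * Diagonal forms and missed progressions *)

Definition diag_rep (a b c n : rat) : Prop :=
  exists x y z : rat, a * x ^+ 2 + b * y ^+ 2 + c * z ^+ 2 = n.

Definition misses_progression (R : rat -> Prop) : Prop :=
  exists a d : nat, [/\ (0 < a)%N, (0 < d)%N & forall k, ~ R (a + k * d)%:R].

(** Thanks to this monotonicity, each change of form below needs only one direction of the rational
    equivalence. *)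
Lemma misses_progression_sub (R S : rat -> Prop) :
  (forall n, R n -> S n) -> misses_progression S -> misses_progression R.
Proof.
by move=> RS [a [d [a0 d0 H]]]; exists a, d; split=> // k /RS; apply: H.
Qed.

(** * Infinite descent on integer solutions *)

(** Dividing all four variables by [p] gives another solution, with smaller [|t|] unless [t = 0]. *)
Lemma int_descent (A B C N : int) (p : nat) : (1 < p)%N ->
  (forall x y z t : int,
     A * x ^+ 2 + B * y ^+ 2 + C * z ^+ 2 = N * t ^+ 2 ->
     [/\ (p %| x)%Z, (p %| y)%Z, (p %| z)%Z & (p %| t)%Z]) ->
  forall x y z t : int,
    A * x ^+ 2 + B * y ^+ 2 + C * z ^+ 2 = N * t ^+ 2 -> t = 0.
Proof.
move=> p1 H x y z t; have [m] := ubnP `|t|%N; elim: m x y z t => // m IH x y z t.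
move=> ltm E; have [] := H _ _ _ _ E.
move=> /dvdzP[x' ex] /dvdzP[y' ey] /dvdzP[z' ez] /dvdzP[t' et].
have p0 : (p : int) != 0 by lia.
have [-> // | t0] := eqVneq t 0; have t'0 : t' != 0.
  by apply: contra_neq t0 => t'0; rewrite et t'0 mul0r.
suff t'E : t' = 0 by rewrite et t'E mul0r.
apply: (IH x' y' z'); first by rewrite et abszM /= in ltm; nia.
apply: (mulIf (expf_neq0 2 p0)); move: E; rewrite ex ey ez et => E.
have -> : N * t' ^+ 2 * (p : int) ^+ 2 = N * (t' * p) ^+ 2 by ring.
by rewrite -E; ring.
Qed.

Lemma diag_rep_int (A B C N : int) : diag_rep A%:~R B%:~R C%:~R N%:~R ->
  exists x y z t : int,
    A * x ^+ 2 + B * y ^+ 2 + C * z ^+ 2 = N * t ^+ 2 /\ t <> 0.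
Proof.
case=> x [y [z E]].
exists (numq x * denq y * denq z), (numq y * denq x * denq z),
  (numq z * denq x * denq y), (denq x * denq y * denq z).
split; last by apply/eqP; rewrite !mulf_neq0 ?denq_neq0.
apply: (@intr_inj rat); rewrite !(rmorphD, rmorphM, rmorphXn) /= -E.
rewrite !numqE; ring.
Qed.

(** Clearing denominators in a rational representation gives an integer solution with [t <> 0],
    which the descent forbids. Only a congruence argument is then left for each form. *)
Lemma diag_rep_descent (A B C N : int) (p : nat) : (1 < p)%N ->
  (forall x y z t : int,
     A * x ^+ 2 + B * y ^+ 2 + C * z ^+ 2 = N * t ^+ 2 ->
     [/\ (p %| x)%Z, (p %| y)%Z, (p %| z)%Z & (p %| t)%Z]) ->
  ~ diag_rep A%:~R B%:~R C%:~R N%:~R.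
Proof.
by move=> p1 H /diag_rep_int[x [y [z [t [/(int_descent p1 H)]]]]].
Qed.

(** * The sum of three squares modulo 8 *)

Lemma sqr_mod8 (x : int) : exists q : int,
  x ^+ 2 = 8 * q /\ (2 %| x)%Z \/ x ^+ 2 = 8 * q + 4 /\ (2 %| x)%Z
  \/ x ^+ 2 = 8 * q + 1.
Proof.
have [q [r [-> r4]]] : exists q r : int, x = 4 * q + r /\ 0 <= r < 4.
  by exists (x %/ 4)%Z, (x %% 4)%Z; lia.
have [->|[->|[->|->]]] : r = 0 \/ r = 1 \/ r = 2 \/ r = 3 by lia.
- by exists (2 * q ^+ 2); left; split; [ring | lia].
- by exists (2 * q ^+ 2 + q); right; right; ring.
- by exists (2 * q ^+ 2 + 2 * q); right; left; split; [ring | lia].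
- by exists (2 * q ^+ 2 + 3 * q + 1); right; right; ring.
Qed.

(** For [N = 7] modulo 8 the equation says that four squares sum to 0 modulo 8. Squares are 0, 1 or
    4, so the number of odd ones is 0 or 4, and four odd squares sum to 4; hence all are even. *)
Lemma sum_three_squares_misses : misses_progression (diag_rep 1 1 1).
Proof.
exists 7%N, 8%N; split=> // k.
apply: (@diag_rep_descent 1 1 1 (Posz (7 + k * 8)) 2) => // x y z t.
have [qx hx] := sqr_mod8 x; have [qy hy] := sqr_mod8 y.
have [qz hz] := sqr_mod8 z; have [qt ht] := sqr_mod8 t.
have -> : Posz (7 + k * 8) * t ^+ 2 = 8 * ((k%:Z + 1) * t ^+ 2) - t ^+ 2.
  by rewrite PoszD PoszM; ring.
move: (_ * t ^+ 2) => w; rewrite !mul1r => E.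
by split; move: E; lia.
Qed.

(** * The obstruction at a prime where [- A] is not a square *)

(** Zero counts as a square, so a prime dividing [A] never obstructs. *)
Definition is_sqr_mod (p a : int) : Prop := exists t : int, (p %| t ^+ 2 - a)%Z.

(** If [x] had an inverse [v] modulo [p], then [y * v] would be a square root of [- A]. So [p]
    divides [x], hence [y ^ 2], hence [y]. *)
Lemma nonresidue_dvd (p : nat) (A x y : int) : prime p ->
  ~ is_sqr_mod p (- A) -> (p %| A * x ^+ 2 + y ^+ 2)%Z ->
  (p %| x)%Z /\ (p %| y)%Z.
Proof.
move=> pr nsq dv.
have px : (p %| x)%Z.
  apply/negPn/negP => npx; apply: nsq.
  have /coprimezP[[u v] /= uv] : coprimez p x.
    by rewrite coprimezE prime_coprime.
  exists (y * v).
  have -> : (y * v) ^+ 2 - - A =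
     (A * x ^+ 2 + y ^+ 2) * v ^+ 2 + A * (1 - (x * v) ^+ 2) by ring.
  apply: rpredD; first exact: dvdz_mulr.
  have -> : A * (1 - (x * v) ^+ 2) = A * (u * p) * (1 + x * v).
    have -> : u * p = 1 - v * x by rewrite -uv; ring.
    by ring.
  by rewrite dvdz_mulr // dvdz_mull // dvdz_mull.
split=> //; have : (p %| y ^+ 2)%Z.
  rewrite -(addKr (A * x ^+ 2) (y ^+ 2)) addrC rpredB // dvdz_mull // exprS.
  exact: dvdz_mulr.
by rewrite !dvdzE abszX Euclid_dvdX //= => /andP[].
Qed.

(** For [N = -1] modulo [p] the equation reduces to [A x^2 + t^2 = 0], so [p] divides [x] and [t].
    As [p] divides [B] exactly once, cancelling one [p] leaves [A z^2 + y^2 = 0] modulo [p], so [p]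
    divides [z] and [y] too. *)
Lemma nonresidue_misses (A B p : nat) : prime p -> (p %| B)%N ->
  ~~ (p ^ 2 %| B)%N -> ~ is_sqr_mod p (- A%:Z) ->
  misses_progression (diag_rep A%:R B%:R (A * B)%:R).
Proof.
move=> pr /dvdnP[b eB] nB nsq; exists p.-1, p; have p1 := prime_gt1 pr.
split; [lia | lia | move=> k].
apply: (@diag_rep_descent A B (A * B)%N (Posz (p.-1 + k * p)) p) => // x y z t E.
have nb : ~~ (p %| b%:Z)%Z.
  by apply: contra nB; rewrite eB dvdzE /= => pb; rewrite expnS expn1 dvdn_mul.
have eN : Posz (p.-1 + k * p) = p%:Z * (k%:Z + 1) - 1 by lia.
have eBz : Posz B = b%:Z * p%:Z by rewrite eB PoszM.
have [px pt] : (p %| x)%Z /\ (p %| t)%Z.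
  apply: (nonresidue_dvd pr nsq); apply/dvdzP.
  exists ((k%:Z + 1) * t ^+ 2 - b%:Z * (y ^+ 2 + A%:Z * z ^+ 2)).
  have -> : A%:Z * x ^+ 2 =
      Posz (p.-1 + k * p) * t ^+ 2 - B%:Z * y ^+ 2 - Posz (A * B) * z ^+ 2.
    by rewrite -E; ring.
  by rewrite eN PoszM eBz; ring.
have [x' ex] := dvdzP px; have [t' et] := dvdzP pt.
have [pz py] : (p %| z)%Z /\ (p %| y)%Z.
  apply: (nonresidue_dvd pr nsq).
  have : (p %| b%:Z * (A%:Z * z ^+ 2 + y ^+ 2))%Z.
    apply/dvdzP; exists (Posz (p.-1 + k * p) * t' ^+ 2 - A%:Z * x' ^+ 2).
    have p0 : (p : int) != 0 by lia.
    apply: (mulIf p0).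
    have -> : (Posz (p.-1 + k * p) * t' ^+ 2 - A%:Z * x' ^+ 2) * p * p =
       Posz (p.-1 + k * p) * t ^+ 2 - A%:Z * x ^+ 2 by rewrite ex et; ring.
    by rewrite -E PoszM eBz; ring.
  move: nb; rewrite !dvdzE abszM Euclid_dvdM // => /negPf.
  by rewrite /= => ->.
by [].
Qed.

(** * Square roots modulo a squarefree number *)

(** Chinese remaindering, one prime at a time: squarefreeness makes the prime split off coprime to
    the cofactor. *)
Lemma is_sqr_mod_squarefree (B : nat) (a : int) : (0 < B)%N ->
  (forall p, prime p -> ~~ (p ^ 2 %| B)%N) ->
  (forall p, prime p -> (p %| B)%N -> is_sqr_mod p a) -> is_sqr_mod B a.
Proof.
have [m] := ubnP B; elim: m B => // m IH B ltm B0 sf sq.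
have [->|B1] := eqVneq B 1%N; first by exists 0; rewrite dvd1z.
have pr : prime (pdiv B) by apply: pdiv_prime; lia.
move: (pdiv B) pr (pdiv_dvd B) => p pr pB; have /dvdnP[b eB] := pB.
have p1 := prime_gt1 pr.
have cpb : coprime p b.
  rewrite prime_coprime //; apply: contra (sf _ pr).
  by rewrite eB mulnC expnS expn1 dvdn_pmul2l // prime_gt0.
have [s /dvdzP [s' hs]] : is_sqr_mod b a.
  apply: IH => [|| q pq | q pq qb]; [nia | nia | |].
  - by apply: contra (sf _ pq) => qb; rewrite eB dvdn_mulr.
  - by apply: sq => //; rewrite eB dvdn_mulr.
have [r /dvdzP [r' hr]] : is_sqr_mod p a := sq p pr pB.
have /coprimezP[[u v] /= uv] : coprimez p b by [].
(* Congruent to [r] modulo [p], and to [s] modulo [b] since [u * p = 1 - v * b]. *)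
exists (r + (s - r) * (u * p)).
rewrite eB mulnC PoszM Gauss_dvdz //; apply/andP; split; apply/dvdzP.
  exists (r' + (s - r) * u * (2 * r + (s - r) * (u * p))).
  by rewrite [RHS]mulrDl -hr; ring.
exists (s' - (s - r) * v * (2 * s - (s - r) * (v * b))).
have -> : r + (s - r) * (u * p) = s - (s - r) * (v * b).
  have -> : u * p = 1 - v * b by rewrite -uv; ring.
  by ring.
by rewrite [RHS]mulrBl -hs; ring.
Qed.

Lemma sqr_mod_half (A B : nat) : (0 < B)%N -> is_sqr_mod B (- A%:Z) ->
  exists t C : nat, (2 * t <= B)%N /\ (t ^ 2 + A = B * C)%N.
Proof.
move=> B0 [t0 /dvdzP[q0 h0]].
have [t [q [t2 h]]] : exists t q : int, (2 * `|t| <= B)%N /\ t ^+ 2 + A = q * B.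
  have [r [w [hr et]]] : exists r w : int, 0 <= r < B /\ t0 = w * B + r.
    exists (t0 %% B)%Z, (t0 %/ B)%Z; rewrite -divz_eq; split=> //.
    by rewrite modz_ge0 ?ltz_pmod; lia.
  have h : r ^+ 2 + A = (q0 - w * (w * B + 2 * r)) * B.
    by rewrite mulrBl -h0 et; ring.
  have [r2|r2] := leqP (2 * `|r|) B; first by exists r, (q0 - w * (w * B + 2 * r)).
  (* A residue above [B / 2] is shifted to the one of least absolute value. *)
  exists (r - B%:Z), (q0 - w * (w * B + 2 * r) + B%:Z - 2 * r); split; first by lia.
  have -> : (r - B%:Z) ^+ 2 + A%:Z = r ^+ 2 + A%:Z + (B%:Z - 2 * r) * B%:Z by ring.
  by rewrite h; ring.
exists `|t|%N, `|q|%N; split=> //.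
nia.
Qed.

(** * Legendre's descent on the forms [<A, B, A B>] *)

Lemma diag_rep_sqr (A b n s : rat) :
  diag_rep A (b * s ^+ 2) (A * (b * s ^+ 2)) n -> diag_rep A b (A * b) n.
Proof. by move=> [x [y [z <-]]]; exists x, (y * s), (z * s); ring. Qed.

Lemma diag_rep_swap (A B n : rat) :
  diag_rep A B (A * B) n -> diag_rep B A (B * A) n.
Proof. by move=> [x [y [z <-]]]; exists y, x, z; ring. Qed.

(* [B B'] is the norm of [t + sqrt (- A)], by which [y + z sqrt (- A)] is
   multiplied. *)
Lemma diag_rep_norm (A B B' t n : rat) : B' != 0 -> t ^+ 2 + A = B * B' ->
  diag_rep A B (A * B) n -> diag_rep A B' (A * B') n.
Proof.
move=> nz e [x [y [z <-]]].
exists x, ((y * t - A * z) / B'), ((y + z * t) / B').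
have -> : A * x ^+ 2 + B * y ^+ 2 + A * B * z ^+ 2 =
  A * x ^+ 2 + (y ^+ 2 + A * z ^+ 2) * (B * B') / B' by field.
by rewrite -e; field.
Qed.

Lemma norm_form_misses (A B : nat) : (0 < A)%N -> (0 < B)%N ->
  misses_progression (diag_rep A%:R B%:R (A%:R * B%:R)).
Proof.
have [m] := ubnP (A + B); elim: m A B => // m IH.
have reduce (A B p : nat) : (A + B < m.+1)%N -> (0 < A)%N -> (0 < B)%N ->
    prime p -> (p ^ 2 %| B)%N ->
    misses_progression (diag_rep A%:R B%:R (A%:R * B%:R)).
  move=> ltm A0 B0 pr /dvdnP[b eB]; have p1 := prime_gt1 pr.
  have eBr : B%:R = b%:R * p%:R ^+ 2 :> rat by rewrite eB natrM natrX.
  apply: (@misses_progression_sub _ (diag_rep A%:R b%:R (A%:R * b%:R))).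
    by move=> n; rewrite eBr; apply: diag_rep_sqr.
  have p4 : (4 <= p ^ 2)%N by rewrite expnS expn1; nia.
  have b0 : (0 < b)%N by move: B0; rewrite eB muln_gt0 => /andP[].
  apply: IH => //; move: (p ^ 2)%N p4 eB => q q4 eB; nia.
have ordered (A B : nat) : (A + B < m.+1)%N -> (0 < A)%N -> (0 < B)%N ->
    (A <= B)%N -> misses_progression (diag_rep A%:R B%:R (A%:R * B%:R)).
  move=> ltm A0 B0 leAB.
  (* Four cases: the base [A = B = 1], a square factor in [B], a prime obstruction, and the norm
     step. *)
  have [B1|B1] := leqP B 1.
    have [-> ->] : A = 1%N /\ B = 1%N by lia.
    by rewrite mulr1; apply: sum_three_squares_misses.
  have [[p [pr pB]]|sf] := classic (exists p, prime p /\ (p ^ 2 %| B)%N).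
    exact: reduce pr pB.
  have {}sf p : prime p -> ~~ (p ^ 2 %| B)%N.
    by move=> pr; apply/negP => pB; apply: sf; exists p.
  have [[p [pr [pB nsq]]]|sq] := classic (exists p, prime p /\ (p %| B)%N /\
      ~ is_sqr_mod p (- A%:Z)).
    rewrite -natrM; exact: nonresidue_misses pr pB (sf p pr) nsq.
  have [t [C [t2 e]]] : exists t C : nat, (2 * t <= B)%N /\ (t ^ 2 + A = B * C)%N.
    apply: sqr_mod_half => //; apply: is_sqr_mod_squarefree => // p pr pB.
    by apply: NNPP => nsq; apply: sq; exists p.
  have C0 : (0 < C)%N by nia.
  (* [B C = t^2 + A <= B^2 / 4 + B] gives [C <= B / 4 + 1], which is below [B] as [B >= 2]. *)
  have ltCB : (C < B)%N by nia.
  apply: (@misses_progression_sub _ (diag_rep A%:R C%:R (A%:R * C%:R))).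
    move=> n; apply: (@diag_rep_norm _ _ _ t%:R); first by rewrite pnatr_eq0 -lt0n.
    by rewrite -natrX -natrD e natrM.
  by apply: IH => //; lia.
move=> A B ltm A0 B0; have [leAB|ltBA] := leqP A B; first exact: ordered.
apply: (@misses_progression_sub _ (diag_rep B%:R A%:R (B%:R * A%:R))).
  by move=> n; apply: diag_rep_swap.
by apply: ordered; rewrite // 1?addnC // ltnW.
Qed.

(** * Diagonalization of a ternary form *)

Lemma qform_evalE (Q : {mpoly rat[3]}) : is_ternary_qform Q ->
  exists a b c d e f : rat, forall x y z, qform_eval Q x y z =
    a * x ^+ 2 + b * y ^+ 2 + c * z ^+ 2 + d * (x * y) + e * (x * z) + f * (y * z).
Proof.
move/dhomogP => hQ; rewrite /qform_eval.
suff: exists a b c d e f : rat, forall x y z,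
    \sum_(m <- msupp Q) Q@_m * \prod_i tnth [tuple x; y; z] i ^+ m i =
    a * x ^+ 2 + b * y ^+ 2 + c * z ^+ 2 + d * (x * y) + e * (x * z) + f * (y * z).
  move=> [a [b [c [d [e [f H]]]]]]; exists a, b, c, d, e, f => x y z.
  by rewrite mevalE H.
(* The induction adds one monomial at a time; the coefficients still come from the fixed [Q]. *)
elim: (msupp Q) hQ => [|m s IH] hQ.
  by exists 0, 0, 0, 0, 0, 0 => x y z; rewrite big_nil; ring.
have [|a [b [c [d [e [f H]]]]]] := IH.
  by move=> k ks; apply: hQ; rewrite inE ks orbT.
have /eqP := hQ m (mem_head _ _).
rewrite /= mdegE !big_ord_recl big_ord0 addn0 => deg.
pose i0 : 'I_3 := ord0; pose i1 : 'I_3 := lift ord0 ord0.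
pose i2 : 'I_3 := lift ord0 (lift ord0 ord0).
have prodE x y z : \prod_i tnth [tuple x; y; z] i ^+ m i =
    x ^+ m i0 * (y ^+ m i1 * z ^+ m i2).
  by rewrite !big_ord_recl big_ord0 mulr1.
rewrite -/i0 -/i1 -/i2 in deg.
move: prodE deg; set q := Q@_m.
(* Degree 2 leaves six monomials, in the order [z^2], [yz], [y^2], [xz], [xy], [x^2]. *)
case: (m i0) (m i1) (m i2) => [|[|[|?]]] [|[|[|?]]] [|[|[|?]]] prodE // _.
- by exists a, b, (c + q), d, e, f => x y z; rewrite big_cons -/q H prodE; ring.
- by exists a, b, c, d, e, (f + q) => x y z; rewrite big_cons -/q H prodE; ring.
- by exists a, (b + q), c, d, e, f => x y z; rewrite big_cons -/q H prodE; ring.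
- by exists a, b, c, d, (e + q), f => x y z; rewrite big_cons -/q H prodE; ring.
- by exists a, b, c, (d + q), e, f => x y z; rewrite big_cons -/q H prodE; ring.
- by exists (a + q), b, c, d, e, f => x y z; rewrite big_cons -/q H prodE; ring.
Qed.

(** Squares are completed in [x], then in [y]. Each diagonal coefficient is positive because it is
    the value of [Q] at a nonzero vector where the other two squares vanish. *)
Lemma posdef_qform_diag (Q : {mpoly rat[3]}) :
  is_ternary_qform Q -> posdef_qform Q ->
  exists a b c : rat, [/\ 0 < a, 0 < b, 0 < c &
    forall n, represented_over_rat Q n -> diag_rep a b c n].
Proof.
move=> /qform_evalE[a [b [c [d [e [f H]]]]]] pos.
have a0 : 0 < a.
  have /pos : (1, 0, 0) <> (0, 0, 0) :> rat * rat * rat by [].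
  by rewrite H; congr (0 < _); ring.
have an0 : a != 0 by rewrite gt_eqF.
pose b1 := b - d ^+ 2 / (4 * a); pose c1 := c - e ^+ 2 / (4 * a).
pose f1 := f - d * e / (2 * a).
have E1 x y z : qform_eval Q x y z = a * (x + (d * y + e * z) / (2 * a)) ^+ 2 +
    (b1 * y ^+ 2 + c1 * z ^+ 2 + f1 * (y * z)).
  by rewrite H /b1 /c1 /f1; field.
have b0 : 0 < b1.
  have /pos : (- d / (2 * a), 1, 0) <> (0, 0, 0) :> rat * rat * rat by [].
  by rewrite E1; congr (0 < _); field.
have bn0 : b1 != 0 by rewrite gt_eqF.
pose c2 := c1 - f1 ^+ 2 / (4 * b1).
have E2 x y z : qform_eval Q x y z = a * (x + (d * y + e * z) / (2 * a)) ^+ 2 +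
    b1 * (y + f1 * z / (2 * b1)) ^+ 2 + c2 * z ^+ 2.
  by rewrite E1 /c2; field; apply/andP.
have c0 : 0 < c2.
  pose y := - f1 / (2 * b1).
  have /pos : (- (d * y + e) / (2 * a), y, 1) <> (0, 0, 0) :> rat * rat * rat.
    by case.
  by rewrite E2; congr (0 < _); rewrite /y; field; apply/andP.
exists a, b1, c2; split=> // n [x [y [z <-]]].
by exists (x + (d * y + e * z) / (2 * a)), (y + f1 * z / (2 * b1)), z; rewrite E2.
Qed.

(** * Scaling a positive diagonal form to [<A, B, A B>] *)

Lemma pos_rat_frac (r : rat) : 0 < r ->
  exists m n : nat, [/\ (0 < m)%N, (0 < n)%N & r = m%:R / n%:R].
Proof.
move=> r0; exists `|numq r|%N, `|denq r|%N; split.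
- by rewrite absz_gt0 numq_eq0 gt_eqF.
- by rewrite absz_gt0 denq_neq0.
- by rewrite !natr_absz !gtr0_norm ?numq_gt0 ?denq_gt0 // divq_num_den.
Qed.

(** With [r = u / v], a term [N] missed by [S] makes [R] miss [u v N], since [r u v N = u^2 N] and
    [S] allows square factors to be removed. *)
Lemma misses_progression_scale (R S : rat -> Prop) (r : rat) : 0 < r ->
  (forall n s, s != 0 -> S (n * s ^+ 2) -> S n) ->
  (forall n, R n -> S (r * n)) -> misses_progression S -> misses_progression R.
Proof.
move=> /pos_rat_frac[u [v [u0 v0 ->]]] sqr RS [a [d [a0 d0 H]]].
have un0 : u%:R != 0 :> rat by rewrite pnatr_eq0 -lt0n.
have vn0 : v%:R != 0 :> rat by rewrite pnatr_eq0 -lt0n.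
exists (u * v * a)%N, (u * v * d)%N; split; rewrite ?muln_gt0 ?u0 ?v0 //.
move=> k /RS h; apply: (H k); apply: (sqr _ u%:R) => //.
by move: h; congr S; rewrite !(natrD, natrM); field.
Qed.

Lemma diag_rep_homog (a b c n s : rat) : s != 0 ->
  diag_rep a b c (n * s ^+ 2) -> diag_rep a b c n.
Proof.
move=> s0 [x [y [z e]]]; exists (x / s), (y / s), (z / s).
by apply: (mulIf (expf_neq0 2 s0)); rewrite -e; field.
Qed.

(** Multiplying by [a b c] turns the form into [bc (a x)^2 + ac (b y)^2 + (bc)(ac) z^2]. With
    [bc = A / u] and [ac = B / v], the integers [A u] and [B v] lie in the same square classes as
    [bc] and [ac]. *)
Lemma pos_diag_misses (a b c : rat) : 0 < a -> 0 < b -> 0 < c ->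
  misses_progression (diag_rep a b c).
Proof.
move=> a0 b0 c0.
have [A [u [A0 u0 eA]]] := pos_rat_frac (mulr_gt0 b0 c0).
have [B [v [B0 v0 eB]]] := pos_rat_frac (mulr_gt0 a0 c0).
have un0 : u%:R != 0 :> rat by rewrite pnatr_eq0 -lt0n.
have vn0 : v%:R != 0 :> rat by rewrite pnatr_eq0 -lt0n.
have cn0 : c != 0 by rewrite gt_eqF.
have Au0 : (0 < A * u)%N by rewrite muln_gt0 A0.
have Bv0 : (0 < B * v)%N by rewrite muln_gt0 B0.
apply: (misses_progression_scale _ _ _ (norm_form_misses Au0 Bv0)).
- exact: (mulr_gt0 (mulr_gt0 a0 b0) c0).
- exact: diag_rep_homog.
move=> n [x [y [z <-]]].
exists (a * x / u%:R), (b * y / v%:R), (z / (u%:R * v%:R)).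
have -> : (A * u)%:R = b * c * u%:R ^+ 2 by rewrite eA natrM; field.
have -> : (B * v)%:R = a * c * v%:R ^+ 2 by rewrite eB natrM; field.
by field; apply/andP.
Qed.

Theorem theorem11 (Q : {mpoly rat[3]})
  (hQ : is_ternary_qform Q) (hpos : posdef_qform Q) :
  exists a d : nat, [/\ (0 < a)%N, (0 < d)%N &
    forall k : nat, ~ represented_over_rat Q (a + k * d)%:R].
Proof.
have [a [b [c [a0 b0 c0 sub]]]] := posdef_qform_diag hQ hpos.
exact: misses_progression_sub sub (pos_diag_misses a0 b0 c0).
Qed.
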